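(* Let $p>1$, $q=p/(p-1)$, and let $k\ge 1$ be an integer. Let $a_m\ge 0$, $b_m\ge 0$, $c_m\ge 0$, $d_m\ge 0$ for $m=0,1,2,\dots$ be real numbers such that the four sums $\sum_{m=1}^{\infty}a_m^p$, $\sum_{m=1}^{\infty}b_m^q$, $\sum_{m=0}^{\infty}c_m^p$, $\sum_{m=0}^{\infty}d_m^q$ are all finite. Then $$k c_0d_0+\sum_{m=1}^{\infty}\sum_{n=1}^{\infty}\left(\frac{a_mb_n}{m+n}+\frac{k\,c_md_n}{m+n+1}\right)\le \frac{\pi}{\sin(\pi/p)}\left(k c_0^p+\sum_{m=1}^{\infty}\left(a_m^p+k c_m^p\right)\right)^{1/p}\left(k d_0^q+\sum_{m=1}^{\infty}\left(b_m^q+k d_m^q\right)\right)^{1/q}.$$ *)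

(* Defs.v *)
From HB Require Import structures.
From mathcomp Require Import all_boot all_order all_algebra.
From mathcomp Require Import all_classical all_reals all_analysis.

(* Main.v *)
Require Import Defs.
From HB Require Import structures.
From mathcomp Require Import all_boot all_order all_algebra.
From mathcomp Require Import all_classical all_reals all_analysis.
From mathcomp Require Import ring lra.
Set Implicit Arguments.
Unset Strict Implicit.
Import Order.TTheory GRing.Theory Num.Theory.
Import numFieldNormedType.Exports.
Local Open Scope classical_set_scope.
Local Open Scope ring_scope.

(** For m, n >= 1 one has 1/(m + n + 1) <= 1/(m + n), so both double sums are
    controlled by Hilbert's inequality with kernel 1/(m + n), and the isolated
    term [c 0 * d 0] costs nothing because the constant C = pi / sin (pi / p)
    is at least 1.  A three-term Hoelder inequality then merges [c 0 * d 0] and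
    the bounds for (a, b) and (c, d) into one product; the factor [k] is
    absorbed beforehand by replacing c and d with k^(1/p) c and k^(1/q) d.

    Hilbert's inequality itself ([hilbert_finite]) comes from Schur's test:
    write a_m b_n as a_m (m/n)^(1/(pq)) times b_n (n/m)^(1/(pq)), apply
    Hoelder's inequality for the weights 1/(m + n), and bound what remains by
    the weight inequality ([weight_le_cosec]), for 0 < s < 1,
      sum_(n >= 1) (m/n)^s / (m + n) <= pi / sin (pi s).
    It is used with s = 1/q and with s = 1/p, which give the same constant.

    The left side is a lower Riemann sum of the integral over (0, +oo) of
    y^(-s)/(1 + y), whose value is pi / sin (pi s).  Only upper bounds are
    needed, and they can be had without integration.  Let
      S_n = sum_(k < n) (-1)^k (1/(k + s) + 1/(k + 1 - s)).
    - An odd number of terms of the geometric series in -y (for y <= 1) or in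
      -1/y (for y >= 1) bounds 1/(1 + y) from above, and it has an explicit
      primitive.  The mean value theorem and telescoping bound the weight by
      S_(2K+1), for every K ([weight_le]).
    - Iterating the duplication formula of the cotangent writes 1/sin (pi s)
      as a sum of 2^j positive differences cot u - cot (u + d); comparing each
      with 1/u - 1/(u + d) gives (1 - 1/M) S_(2M) <= pi / sin (pi s) for
      M = 2^i ([alternating_sum_le]).
    Since S_(2M+1) - S_(2M) <= 1/M, letting M grow proves the weight
    inequality. *)

(** * Cotangents and the partial fractions of the cosecant *)

Lemma sin_mean_value (R : realType) (x : R) : 0 < x ->
  exists2 y, 0 < y < x & sin x = x * cos y.
Proof.
move=> x0.
have [|y] := @MVT R sin cos 0 x x0 (fun y _ => is_derive_sin y).
  by apply: continuous_subspaceT => y; exact: continuous_sin.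
rewrite in_itv /= sin0 !subr0 => y0x ->.
by exists y => //; rewrite mulrC.
Qed.

Lemma sin_le_id (R : realType) (x : R) : 0 <= x -> sin x <= x.
Proof.
rewrite le_eqVlt => /predU1P[<-|x0]; first by rewrite sin0.
have [y _ ->] := sin_mean_value x0.
by apply: ler_piMr; [exact: ltW | exact: cos_le1].
Qed.

(** A crude quantitative form of sin x / x -> 1: by the mean value theorem
    sin x = x cos y, and cos y >= cos^2 y = 1 - sin^2 y >= 1 - x. *)
Lemma sin_ge_onem (R : realType) (x : R) : 0 < x -> x <= 1 ->
  x * (1 - x) <= sin x.
Proof.
move=> x0 x1; have [y /andP[y0 yx] ->] := sin_mean_value x0.
rewrite ler_pM2l//.
have cy : 0 <= cos y.
  apply: cos_ge0_pihalf; have := @pihalf_ge1 R; lra.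
have c1 := cos_le1 y.
have s1 := sin_le_id (ltW y0).
have s0 : 0 <= sin y.
  by apply: sin_ge0_pi; have := @pi_ge2 R; lra.
have := cos2sin2 y; nra.
Qed.

Definition cot (R : realType) (x : R) : R := cos x / sin x.

Lemma cot_shift (R : realType) (x : R) :
  cot (x + pi / 2) = - (sin x / cos x).
Proof. by rewrite /cot cosDpihalf sinDpihalf mulNr. Qed.

(** No hypothesis on [x]: at the poles the convention 1/0 = 0 makes both
    sides vanish. *)
Lemma cot_duplication (R : realType) (x : R) :
  cot x = (cot (x / 2) + cot (x / 2 + pi / 2)) / 2.
Proof.
rewrite cot_shift /cot.
have -> : cos x = cos (x / 2) ^+ 2 - sin (x / 2) ^+ 2.
  by rewrite {1}(splitr x) cosD -!expr2.
have -> : sin x = 2 * (sin (x / 2) * cos (x / 2)).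
  by rewrite {1}(splitr x) sinD; ring.
set c := cos _; set s := sin _.
have [->|s0] := eqVneq s 0.
  by rewrite !(mul0r, mulr0, invr0, oppr0, addr0).
have [->|c0] := eqVneq c 0.
  by rewrite !(mul0r, mulr0, invr0, oppr0, addr0).
by field; rewrite s0 c0.
Qed.

Lemma cosec_cot (R : realType) (x : R) :
  (sin x)^-1 = (cot (x / 2) - cot (x / 2 + pi / 2)) / 2.
Proof.
rewrite cot_shift /cot.
have -> : sin x = 2 * (sin (x / 2) * cos (x / 2)).
  by rewrite {1}(splitr x) sinD; ring.
have := cos2Dsin2 (x / 2).
set c := cos _; set s := sin _ => cs.
have [->|s0] := eqVneq s 0.
  by rewrite !(mul0r, mulr0, invr0, oppr0, addr0).
have [->|c0] := eqVneq c 0.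
  by rewrite !(mul0r, mulr0, invr0, oppr0, addr0).
have -> : (2 * (s * c))^-1 = (c ^+ 2 + s ^+ 2) / (2 * (s * c)) by rewrite cs mul1r.
by field; rewrite s0 c0.
Qed.

(** Duplicating every term of the sum for 2^j sends the index k to k and
    k + 2^j, so the two halves concatenate into the sum for 2^(j+1). *)
Lemma cot_multiplication (R : realType) (x : R) (j : nat) :
  cot x = (\sum_(k < 2 ^ j) cot ((x + k%:R * pi) / (2 ^ j)%:R)) / (2 ^ j)%:R.
Proof.
elim: j => [|j IH].
  by rewrite expn0 big_ord1 /= mul0r addr0 !divr1.
have N0 : (2 ^ j)%:R != 0 :> R by rewrite pnatr_eq0 expn_eq0.
rewrite expnS mul2n -addnn big_split_ord /= -big_split /= IH.
under [in LHS]eq_bigr do rewrite cot_duplication.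
rewrite -mulr_suml -mulrA -invfM natrD; congr (_ * _); last by congr (_^-1); ring.
apply: eq_bigr => k _; rewrite natrD; congr (cot _ + cot _); by field; lra.
Qed.

Lemma cot_piB (R : realType) (x : R) : cot (pi - x) = - cot x.
Proof.
by rewrite /cot cosB sinB cospi sinpi; rewrite !mul0r addr0 mulN1r mulN1r sub0r opprK mulNr.
Qed.

(** The difference of cotangents is sin d / (sin u sin (u + d)).  Since
    sin <= id in the denominator, it dominates 1/u - 1/(u + d) up to the
    factor sin d / d. *)
Lemma cotB_ge (R : realType) (u d : R) :
  0 < u -> 0 < d -> d <= 1 -> u + d < pi ->
  (1 - d) * (u^-1 - (u + d)^-1) <= cot u - cot (u + d).
Proof.
move=> u0 d0 d1 udpi.
have su : 0 < sin u by apply: sin_gt0_pi; lra.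
have sud : 0 < sin (u + d) by apply: sin_gt0_pi; lra.
have -> : cot u - cot (u + d) = sin d / (sin u * sin (u + d)).
  have -> : sin d = sin (u + d) * cos u - cos (u + d) * sin u.
    by rewrite -sinB; congr sin; ring.
  by rewrite /cot; field; rewrite !gt_eqF.
have -> : (1 - d) * (u^-1 - (u + d)^-1) = d * (1 - d) / (u * (u + d)).
  by field; rewrite !gt_eqF//; lra.
apply: ler_pM.
- by rewrite mulr_ge0//; lra.
- by rewrite invr_ge0 mulr_ge0//; lra.
- exact: sin_ge_onem.
- rewrite lef_pV2 ?posrE ?mulr_gt0//; last lra.
  by apply: ler_pM (ltW su) (ltW sud) _ _; apply: sin_le_id; lra.
Qed.

(** The alternating partial fraction expansion of pi / sin (pi s), in which
    the poles -k and k + 1 are grouped together. *)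
Definition alternating_sum (R : realType) (s : R) (n : nat) : R :=
  \sum_(k < n) (-1) ^+ k * ((k%:R + s)^-1 + (k%:R + (1 - s))^-1).

(** The multiplication formula with N = 2M terms, applied to the two
    cotangents whose difference is 2 / sin (pi s), expresses pi / sin (pi s)
    through differences over intervals of length d = pi / (4M).  The first
    half of them corresponds to the poles at -k; the second half, reflected
    by x |-> pi - x, to those at k + 1, that is, to s replaced by 1 - s. *)
Lemma alternating_sum_le (R : realType) (s : R) (i : nat) : 0 < s -> s < 1 ->
  (1 - (2 ^ i)%:R^-1) * alternating_sum s (2 ^ i).*2 <= pi / sin (pi * s).
Proof.
move=> s0 s1.
set M := (2 ^ i)%N.
have M1 : 1 <= M%:R :> R by rewrite ler1n expn_gt0.
have pi2 := @pi_ge2 R.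
have pi4 : pi <= 4 :> R by have := @pihalf_lt2 R; lra.
set d : R := pi / (4 * M%:R).
have d0 : 0 < d by rewrite divr_gt0//; lra.
have dM : d <= M%:R^-1.
  rewrite /d invfM mulrA ler_piMl ?invr_ge0//; lra.
have d1 : d <= 1.
  by apply: (le_trans dM); rewrite invf_le1//; lra.
have dME : d * M%:R = pi / 4 by rewrite /d; field; lra.
pose u (t : R) (k : nat) : R := (t + 2 * k%:R) * d.
have E : pi / sin (pi * s) =
   d * \sum_(k < M + M) (cot (u s k) - cot (u s k + d)).
  rewrite cosec_cot.
  rewrite (cot_multiplication _ i.+1) (cot_multiplication (_ + pi / 2) i.+1).
  rewrite expnS mul2n -addnn -/M -mulrBl -sumrB.
  set S := bigop _ _ _.
  have -> : pi * (S / (M + M)%:R / 2) = d * S by rewrite natrD /d; field; lra.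
  congr (_ * _).
  apply: eq_bigr => k _; rewrite natrD /u /d.
  by congr (cot _ - cot _); field; lra.
have A : alternating_sum s M.*2 = d * \sum_(k < M)
   (((u s k)^-1 - (u s k + d)^-1) + ((u (1 - s) k)^-1 - (u (1 - s) k + d)^-1)).
  rewrite /alternating_sum; elim: (M) => [|m IH].
    by rewrite !big_ord0 mulr0.
  rewrite doubleS !big_ord_recr /= [RHS]mulrDr -IH -addrA; congr (_ + _).
  rewrite exprS -signr_odd odd_double expr0 mulr1 mul1r mulN1r -muln2.
  rewrite -natr1 natrM /u.
  have m0 : 0 <= m%:R :> R by [].
  by field; rewrite !gt_eqF//; nra.
(* The second half of the sum is read backwards: k becomes 2M - 1 - k. *)
rewrite E A big_split_ord /= [X in _ <= _ * (_ + X)](reindex_inj rev_ord_inj) /= -big_split /=.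
rewrite mulrCA ler_pM2l// mulr_sumr ler_sum// => k _.
have kM : k%:R + 1 <= M%:R :> R by rewrite natr1 ler_nat.
have k0 : 0 <= k%:R :> R by [].
have step t : 0 < t -> t < 1 ->
    (1 - M%:R^-1) * ((u t k)^-1 - (u t k + d)^-1) <= cot (u t k) - cot (u t k + d).
  move=> t0 t1; have u0 : 0 < u t k by rewrite mulr_gt0//; lra.
  apply: (@le_trans _ _ ((1 - d) * ((u t k)^-1 - (u t k + d)^-1))).
    by rewrite ler_wpM2r ?subr_ge0 ?lef_pV2 ?posrE//; lra.
  apply: cotB_ge => //; rewrite /u.
  have : (t + 2 * k%:R + 1) * d < 2 * (M%:R * d) by rewrite mulrA ltr_pM2r//; lra.
  by rewrite [M%:R * d]mulrC dME; lra.
rewrite mulrDr lerD ?step//.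
have -> : u s (M + (M - k.+1))%N = pi - (u (1 - s) k + d).
  rewrite /u natrD natrB// -natr1.
  have -> : pi = d * M%:R * 4 by rewrite dME; field.
  by ring.
have -> : pi - (u (1 - s) k + d) + d = pi - u (1 - s) k by ring.
by rewrite !cot_piB opprK [leRHS]addrC step//; lra.
Qed.

(** * Upper bounds for the Riemann sums of the kernel *)

(** The remainder of a geometric series in -y, cut after an odd number of
    terms, is y^(2K+1)/(1 + y), which is nonnegative. *)
Lemma odd_geometric_ge (R : realType) (y : R) (K : nat) : 0 <= y ->
  (1 + y)^-1 <= \sum_(k < K.*2.+1) (-1) ^+ k * y ^+ k.
Proof.
move=> y0; have y1 : 0 < 1 + y by lra.
have sy : \sum_(k < K.*2.+1) (-1) ^+ k * y ^+ k = (1 + y ^+ K.*2.+1) / (1 + y).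
  apply: (canRL (mulfK (lt0r_neq0 y1))).
  under eq_bigr do rewrite -exprMn mulN1r.
  apply: oppr_inj; rewrite mulrC -mulNr opprD addrC -subrX1.
  by rewrite exprNn exprS -signr_odd odd_double expr0; ring.
by rewrite sy -[leLHS]mul1r ler_pM2r ?invr_gt0// lerDl exprn_ge0.
Qed.

(** Termwise primitive of the sum of (-1)^k y^(e k - 1).  The exponents
    e k = k + 1 - s serve for y <= 1 and e k = - (k + s) for y >= 1. *)
Definition alternating_primitive (R : realType) (e : nat -> R) (n : nat) (y : R) : R :=
  \sum_(k < n) (-1) ^+ k * (y `^ e k / e k).

Lemma is_derive_alternating_primitive (R : realType) (e : nat -> R) (n : nat) (y : R) :
  0 < y -> (forall k, e k != 0) ->
  is_derive y 1 (alternating_primitive e n)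
    (\sum_(k < n) (-1) ^+ k * y `^ (e k - 1)).
Proof.
move=> y0 e0.
have -> : alternating_primitive e n =
    \sum_(k < n) ((-1) ^+ k / e k) \*: (fun z : R => z `^ e k).
  apply/funext => z; rewrite fct_sumE /alternating_primitive.
  by apply: eq_bigr => k _; rewrite /= /GRing.scale /=; ring.
have -> : \sum_(k < n) (-1) ^+ k * y `^ (e k - 1) =
    \sum_(k < n) ((-1) ^+ k / e k) *: (e k * y `^ (e k - 1)).
  by apply: eq_bigr => k _; rewrite /GRing.scale /=; field.
apply: is_derive_sum => k.
apply: is_deriveZ; exact: is_derive1_powR.
Qed.

(** The closed endpoint 0 matters: the first cell of the Riemann sum starts
    there, and the mean value theorem is applied on it. *)
Lemma powR_within_continuous (R : realType) (r b : R) : 0 < r -> 0 < b ->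
  {within `[0, b], continuous (fun z : R => z `^ r)}.
Proof.
move=> r0 b0; have C y : 0 < y -> {for y, continuous (fun z : R => z `^ r)}.
  move=> y0; apply/differentiable_continuous/derivable1_diffP.
  by apply: derivable_powR; rewrite in_itv /= andbT.
apply/continuous_within_itvP => //; split.
- by move=> y; rewrite in_itv /= => /andP[/C].
- by rewrite powR0 ?gt_eqF//; exact: powR_cvg0.
- by apply: cvg_at_left_filter; exact: C.
Qed.

Lemma alternating_primitive_within_continuous (R : realType) (e : nat -> R) (n : nat) (b : R) :
  0 < b -> (forall k, 0 < e k) ->
  {within `[0, b], continuous (alternating_primitive e n)}.
Proof.
move=> b0 e0; elim: n => [|n IH].
  have -> : alternating_primitive e 0 = cst 0.
    by apply/funext => z; rewrite /alternating_primitive big_ord0.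
  move=> x; exact: cst_continuous.
have -> : alternating_primitive e n.+1 = (fun y => alternating_primitive e n y +
    (-1) ^+ n * (y `^ e n / e n)).
  by apply/funext => z; rewrite /alternating_primitive big_ord_recr.
move=> x; apply: cvgD; first exact: IH.
apply: cvgMr; apply: cvgMl; exact: powR_within_continuous.
Qed.

Lemma increment_ge (R : realType) (f df : R -> R) (a b c : R) : a < b ->
  {within `[a, b], continuous f} ->
  (forall y, a < y < b -> is_derive y 1 f (df y)) ->
  (forall y, a < y < b -> c <= df y) ->
  c * (b - a) <= f b - f a.
Proof.
move=> ab cf fdf dfc.
have fd y : y \in `]a, b[ -> is_derive y 1 f (df y) by rewrite in_itv /= => /fdf.
have [y] := MVT ab fd cf.
by rewrite in_itv /= => yab ->; rewrite ler_wpM2r ?dfc//; lra.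
Qed.

Lemma alternating_ge0 (R : realType) (v : nat -> R) (K : nat) :
  (forall k, 0 <= v k) -> (forall k, v k.+1 <= v k) ->
  0 <= \sum_(k < K.*2.+1) (-1) ^+ k * v k.
Proof.
move=> v0 dv; apply: (le_trans (v0 K.*2)); elim: K => [|K IH].
  by rewrite big_ord1 expr0 mul1r.
rewrite doubleS 2!big_ord_recr /= !exprS -signr_odd odd_double expr0.
by have := dv K.*2; lra.
Qed.

(** One cell of the Riemann sum: the kernel is decreasing, so its value at
    the right endpoint [b] is a lower bound for the derivative of the
    primitive on the whole cell. *)
Lemma kernel_le_increment (R : realType) (s a b : R) (e : nat -> R) (n : nat) :
  0 < s -> 0 <= a -> a < b -> (forall k, e k != 0) ->
  {within `[a, b], continuous (alternating_primitive e n)} ->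
  (forall y, 0 < y -> y `^ (- s) / (1 + y) <= \sum_(k < n) (-1) ^+ k * y `^ (e k - 1)) ->
  b `^ (- s) / (1 + b) * (b - a) <=
    alternating_primitive e n b - alternating_primitive e n a.
Proof.
move=> s0 a0 ab e0 ce le_e.
apply: increment_ge => // [y /andP[ay yb]|y /andP[ay yb]].
  by apply: is_derive_alternating_primitive => //; lra.
apply: le_trans (le_e y _); last lra.
apply: ler_pM; rewrite ?powR_ge0 ?invr_ge0 ?lef_pV2 ?posrE//; try lra.
rewrite !powRN lef_pV2 ?posrE ?powR_gt0//; try lra.
by rewrite ge0_ler_powR ?nnegrE//; lra.
Qed.

Lemma kernel_le_near0 (R : realType) (s y : R) (K : nat) : 0 < y ->
  y `^ (- s) / (1 + y) <=
  \sum_(k < K.*2.+1) (-1) ^+ k * y `^ (k%:R + (1 - s) - 1).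
Proof.
move=> y0; have y1 := odd_geometric_ge K (ltW y0).
apply: (@le_trans _ _ (y `^ (- s) * \sum_(k < K.*2.+1) (-1) ^+ k * y ^+ k)).
  by rewrite ler_wpM2l ?powR_ge0.
rewrite mulr_sumr ler_sum// => k _.
have -> : k%:R + (1 - s) - 1 = - s + k%:R by ring.
rewrite powRD; last by rewrite (gt_eqF y0) implybT.
by rewrite powR_mulrn; [rewrite mulrCA|exact: ltW].
Qed.

Lemma kernel_le_near_infty (R : realType) (s y : R) (K : nat) : 0 < y ->
  y `^ (- s) / (1 + y) <=
  \sum_(k < K.*2.+1) (-1) ^+ k * y `^ (- (k%:R + s) - 1).
Proof.
move=> y0; have yV0 : 0 < y^-1 by rewrite invr_gt0.
have y1 := odd_geometric_ge K (ltW yV0).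
apply: (@le_trans _ _ (y `^ (- s) * (y^-1 * \sum_(k < K.*2.+1) (-1) ^+ k * y^-1 ^+ k))).
  rewrite ler_wpM2l ?powR_ge0//.
  have -> : (1 + y)^-1 = y^-1 * (1 + y^-1)^-1 by field; rewrite !gt_eqF//; lra.
  by rewrite ler_wpM2l ?(ltW yV0).
rewrite mulrA mulr_sumr ler_sum// => k _.
have -> : - (k%:R + s) - 1 = - s + - (k.+1)%:R by rewrite -natr1; ring.
rewrite powRD; last by rewrite (gt_eqF y0) implybT.
rewrite powR_invn; last exact: ltW.
rewrite -exprVn exprS.
by rewrite le_eqVlt; apply/predU1P; left; ring.
Qed.

(** The kernel is homogeneous of degree -1; after rescaling by [x] the
    summand of the weight at [y] belongs to a cell of length 1/x that ends at
    y/x. *)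
Lemma kernel_rescale (R : realType) (s x y : R) : 0 < x -> 0 < y ->
  (x / y) `^ s / (x + y) = (y / x) `^ (- s) / (1 + y / x) / x.
Proof.
move=> x0 y0.
have -> : x / y = (y / x)^-1 by rewrite invf_div.
rewrite -powR_inv1; last by rewrite divr_ge0// ltW.
rewrite -powRrM mulN1r -mulrA -invfM.
by congr (_ / _); field; rewrite gt_eqF.
Qed.

(** The grid points n/(m + 1) include 1, where the two primitives take over
    from one another.  The sum is first extended past 1, so that both ranges
    are complete; the primitive [A] contributes A 1 - A 0 = A 1 and [B] at
    most - B 1, and these add up to the alternating sum. *)
Lemma weight_le (R : realType) (s : R) (m L K : nat) : 0 < s -> s < 1 ->
  \sum_(0 <= n < L) ((m.+1%:R / n.+1%:R) `^ s / (m.+1 + n.+1)%:R) <=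
  alternating_sum s K.*2.+1.
Proof.
move=> s0 s1; set M : R := m.+1%:R.
have M0 : 0 < M by rewrite ltr0n.
pose A := alternating_primitive (fun k => k%:R + (1 - s)) K.*2.+1.
pose B := alternating_primitive (fun k => - (k%:R + s)) K.*2.+1.
have e1 k : 0 < k%:R + (1 - s) by rewrite ltr_wpDl// subr_gt0.
have e2 k : - (k%:R + s) < 0 by rewrite oppr_lt0 ltr_wpDl.
have frac n : (n%:R / M < n.+1%:R / M) by rewrite ltr_pM2r ?invr_gt0// ltr_nat.
have diff n : M^-1 = n.+1%:R / M - n%:R / M by rewrite -mulrBl -natr1 addrAC subrr add0r mul1r.
(* Left of 1 the primitive A is used, right of 1 the primitive B. *)
have near0 n : (M / n.+1%:R) `^ s / (m.+1 + n.+1)%:R <= A (n.+1%:R / M) - A (n%:R / M).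
  rewrite natrD kernel_rescale// [X in _ * X <= _](diff n).
  apply: kernel_le_increment => //.
  - by rewrite divr_ge0// ltW.
  - by move=> k; rewrite gt_eqF.
  - apply: (continuous_subspaceW (B := `[0, n.+1%:R / M])); last first.
      by apply: alternating_primitive_within_continuous => //; rewrite divr_gt0.
    by apply: subset_itvr; rewrite bnd_simp divr_ge0// ltW.
  - by move=> y; exact: kernel_le_near0.
have near_infty n : (0 < n)%N ->
    (M / n.+1%:R) `^ s / (m.+1 + n.+1)%:R <= B (n.+1%:R / M) - B (n%:R / M).
  move=> n0; have nM : 0 < n%:R / M by rewrite divr_gt0 ?ltr0n.
  rewrite natrD kernel_rescale// [X in _ * X <= _](diff n).
  apply: kernel_le_increment => //.
  - by rewrite ltW.
  - by move=> k; rewrite lt_eqF.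
  - apply: derivable_within_continuous => y; rewrite in_itv /= => /andP[ny _].
    have y0 : 0 < y := lt_le_trans nM ny.
    have [] // := @is_derive_alternating_primitive R (fun k => - (k%:R + s)) K.*2.+1 y y0.
    by move=> k; rewrite lt_eqF.
  - by move=> y; exact: kernel_le_near_infty.
(* B y is minus an alternating sum of decreasing terms. *)
have B0 y : 1 <= y -> B y <= 0.
  move=> y1.
  rewrite -oppr_ge0 /B /alternating_primitive -sumrN.
  rewrite (eq_bigr (fun k : 'I_ _ => (-1) ^+ k * (y `^ (- (k%:R + s)) / (k%:R + s)))); last first.
    by move=> k _; rewrite invrN; ring.
  apply: (alternating_ge0 (v := fun k => y `^ (- (k%:R + s)) / (k%:R + s))) => k.
    by rewrite divr_ge0 ?powR_ge0//; have := e2 k; lra.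
  have := e2 k; have := e2 k.+1; rewrite -natr1 => ? ?.
  apply: ler_pM; rewrite ?powR_ge0 ?invr_ge0 ?lef_pV2 ?posrE//; try lra.
  by apply: ler_powR => //; lra.
(* Extend the range to m + 1 + L terms and cut it at the grid point 1. *)
apply: (@le_trans _ _ (\sum_(0 <= n < m.+1 + L) ((M / n.+1%:R) `^ s / (m.+1 + n.+1)%:R))).
  rewrite [leRHS](@big_cat_nat _ _ _ L) ?leq_addl//= lerDl sumr_ge0// => n _.
  by rewrite divr_ge0 ?powR_ge0.
rewrite (@big_cat_nat _ _ _ m.+1) ?leq_addr//=.
apply: (@le_trans _ _ ((A 1 - A 0) + (B ((m.+1 + L)%:R / M) - B 1))).
  have MM : m.+1%:R / M = 1 by rewrite divff ?gt_eqF.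
  have M0' : 0%:R / M = 0 by rewrite mul0r.
  have /= := @telescope_sumr R _ _ (fun n => A (n%:R / M)) (leq0n m.+1).
  rewrite MM M0' => <-.
  have /= := @telescope_sumr R _ _ (fun n => B (n%:R / M)) (leq_addr L m.+1).
  rewrite MM => <-.
  apply: lerD; apply: ler_sum_nat => n /andP[mn _]; first exact: near0.
  by apply: near_infty; exact: leq_trans mn.
have -> : A 0 = 0.
  by rewrite /A /alternating_primitive big1// => k _; rewrite powR0 ?gt_eqF// mul0r mulr0.
have -> : alternating_sum s K.*2.+1 = A 1 - B 1.
  rewrite /alternating_sum -sumrB; apply: eq_bigr => k _.
  by rewrite !powR1 !div1r invrN; ring.
suff /B0 : 1 <= (m.+1 + L)%:R / M by lra.
by rewrite ler_pdivlMr// mul1r ler_nat leq_addr.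
Qed.

(** * The weight inequality *)

(** If the weight W exceeded C = pi / sin (pi s), then combining [weight_le]
    and [alternating_sum_le] at M = 2^i would give W - C <= (1 + W)/M for
    every i, which fails for large i. *)
Lemma weight_le_cosec (R : realType) (s : R) (m L : nat) : 0 < s -> s < 1 ->
  \sum_(0 <= n < L) ((m.+1%:R / n.+1%:R) `^ s / (m.+1 + n.+1)%:R) <=
  pi / sin (pi * s).
Proof.
move=> s0 s1; set W := bigop _ _ _; set C := pi / _.
rewrite leNgt; apply/negP => CW.
pose i := Num.bound `|(1 + W) / (W - C)|.
have Hi : (1 + W) / (W - C) < (2 ^ i)%:R.
  apply: le_lt_trans (ler_norm _) _.
  apply: lt_le_trans (archi_boundP (normr_ge0 _)) _.
  by rewrite ler_nat; apply: ltnW; apply: ltn_expl.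
have M1 : 1 <= (2 ^ i)%:R :> R by rewrite ler1n expn_gt0.
have HW : W <= _ := weight_le m L (2 ^ i) s0 s1.
have HC : _ <= C := alternating_sum_le i s0 s1.
move: HW HC Hi M1; rewrite /alternating_sum big_ord_recr /= -/(alternating_sum s _).
rewrite -signr_odd odd_double expr0 mul1r -muln2 natrM.
(* The last term of the sum, of even index 2M, is at most 1/M. *)
move: (alternating_sum _ _) (2 ^ i)%:R => A M HW HC Hi M1.
have E1 : (M * 2 + s)^-1 <= M^-1 / 2 by rewrite -invfM lef_pV2 ?posrE; lra.
have E2 : (M * 2 + (1 - s))^-1 <= M^-1 / 2 by rewrite -invfM lef_pV2 ?posrE; lra.
move: Hi; rewrite ltr_pdivrMr ?subr_gt0// => Hi.
have v1 : M^-1 <= 1 by rewrite invf_le1//; lra.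
have v0 : 0 < M^-1 by rewrite invr_gt0; lra.
have vM : M^-1 * M = 1 by rewrite mulVf//; lra.
move: (M^-1) v1 v0 vM E1 E2 HC => v v1 v0 vM E1 E2 HC.
have HA : W - v <= A by lra.
have HA' : (1 - v) * (W - v) <= C by apply: le_trans HC; rewrite ler_wpM2l//; lra.
have : v * (1 + W) < W - C.
  have -> : W - C = v * (M * (W - C)) by rewrite mulrA vM mul1r.
  by rewrite ltr_pM2l.
have vv : 0 < v * v by rewrite mulr_gt0.
have : (1 - v) * (W - v) = W - v * (1 + W) + v * v by ring.
by lra.
Qed.

(** * Hoelder's and Hilbert's inequalities for finite sums *)

Lemma powRVK (R : realType) (x r : R) : 0 <= x -> r != 0 -> (x `^ r^-1) `^ r = x.
Proof. by move=> x0 r0; rewrite -powRrM mulVf// powRr1. Qed.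

Lemma powR_le (R : realType) (r x y : R) : 0 < r -> 0 <= x -> x <= y ->
  x `^ r <= y `^ r.
Proof.
move=> r0 x0 xy; apply: ge0_ler_powR; rewrite ?nnegrE//; first exact: ltW.
exact: le_trans xy.
Qed.

(** Induction from the two-term inequality: the tail is carried along as the
    single pair of its norms. *)
Lemma hoelder_sum (R : realType) (I : Type) (r : seq I) (x y : I -> R) (p q : R) :
  (forall i, 0 <= x i) -> (forall i, 0 <= y i) ->
  0 < p -> 0 < q -> p^-1 + q^-1 = 1 ->
  \sum_(i <- r) x i * y i <=
    (\sum_(i <- r) x i `^ p) `^ p^-1 * (\sum_(i <- r) y i `^ q) `^ q^-1.
Proof.
move=> x0 y0 p0 q0 pq; elim: r => [|i r IH].
  by rewrite !big_nil mulr_ge0 ?powR_ge0.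
have X0 : 0 <= \sum_(i <- r) x i `^ p by rewrite sumr_ge0// => j _; exact: powR_ge0.
have Y0 : 0 <= \sum_(i <- r) y i `^ q by rewrite sumr_ge0// => j _; exact: powR_ge0.
rewrite !big_cons; apply: (le_trans (lerD (lexx _) IH)).
rewrite -{2}(powRVK X0 (lt0r_neq0 p0)) -{2}(powRVK Y0 (lt0r_neq0 q0)).
by apply: hoelder2; rewrite ?powR_ge0.
Qed.

Lemma hoelder_double_sum (R : realType) (I J : Type) (r : seq I) (r' : seq J)
    (x y : I -> J -> R) (p q : R) :
  (forall i j, 0 <= x i j) -> (forall i j, 0 <= y i j) ->
  0 < p -> 0 < q -> p^-1 + q^-1 = 1 ->
  \sum_(i <- r) \sum_(j <- r') x i j * y i j <=
    (\sum_(i <- r) \sum_(j <- r') x i j `^ p) `^ p^-1 *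
    (\sum_(i <- r) \sum_(j <- r') y i j `^ q) `^ q^-1.
Proof.
move=> x0 y0 p0 q0 pq.
have X0 i : 0 <= \sum_(j <- r') x i j `^ p by rewrite sumr_ge0// => j _; exact: powR_ge0.
have Y0 i : 0 <= \sum_(j <- r') y i j `^ q by rewrite sumr_ge0// => j _; exact: powR_ge0.
pose X i := (\sum_(j <- r') x i j `^ p) `^ p^-1.
pose Y i := (\sum_(j <- r') y i j `^ q) `^ q^-1.
apply: (@le_trans _ _ (\sum_(i <- r) X i * Y i)).
  by apply: ler_sum => i _; exact: hoelder_sum.
have -> : \sum_(i <- r) \sum_(j <- r') x i j `^ p = \sum_(i <- r) X i `^ p.
  by apply: eq_bigr => i _; rewrite /X powRVK// lt0r_neq0.
have -> : \sum_(i <- r) \sum_(j <- r') y i j `^ q = \sum_(i <- r) Y i `^ q.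
  by apply: eq_bigr => i _; rewrite /Y powRVK// lt0r_neq0.
by apply: hoelder_sum => // i; exact: powR_ge0.
Qed.

(** Schur's test.  The powers of m/n are chosen so that they cancel in the
    product of the two factors, while in the p-th and q-th powers they leave
    the exponents 1/q and 1/p of the weight inequality. *)
Lemma hilbert_finite (R : realType) (p q : R) (a b : nat -> R) (M N : nat) :
  (forall m, 0 <= a m) -> (forall n, 0 <= b n) ->
  0 < p -> 0 < q -> p^-1 + q^-1 = 1 ->
  \sum_(1 <= m < M) \sum_(1 <= n < N) a m * b n / (m + n)%:R <=
  pi / sin (pi / p) * (\sum_(1 <= m < M) a m `^ p) `^ p^-1 *
    (\sum_(1 <= n < N) b n `^ q) `^ q^-1.
Proof.
move=> a0 b0 p0 q0 pq.
have pV0 : 0 < p^-1 by rewrite invr_gt0.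
have qV0 : 0 < q^-1 by rewrite invr_gt0.
set C := pi / sin (pi / p).
have weight_p m L : \sum_(0 <= n < L) ((m.+1%:R / n.+1%:R) `^ p^-1 / (m.+1 + n.+1)%:R) <= C.
  by apply: weight_le_cosec => //; lra.
have weight_q m L : \sum_(0 <= n < L) ((m.+1%:R / n.+1%:R) `^ q^-1 / (m.+1 + n.+1)%:R) <= C.
  apply: le_trans (weight_le_cosec _ _ qV0 _) _; first lra.
  rewrite (_ : pi * q^-1 = pi - pi / p); last by rewrite -{2}(mulr1 pi) -pq; ring.
  by rewrite sinB sinpi cospi; rewrite mul0r mulN1r sub0r opprK.
have C0 : 0 <= C by apply: le_trans (weight_p 0%N 0%N); rewrite big_geq.
rewrite 2!big_add1 [X in _ * X `^ _]big_add1.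
under eq_bigr do rewrite big_add1.
set M' := M.-1; set N' := N.-1.
pose w (m n : nat) : R := (m.+1 + n.+1)%:R^-1.
pose r (m n : nat) : R := m.+1%:R / n.+1%:R.
have w0 m n : 0 <= w m n by rewrite invr_ge0.
have r0 m n : 0 < r m n by rewrite divr_gt0.
pose x m n := a m.+1 * r m n `^ (p * q)^-1 * w m n `^ p^-1.
pose y m n := b n.+1 * r n m `^ (p * q)^-1 * w m n `^ q^-1.
have x0 m n : 0 <= x m n by rewrite !mulr_ge0 ?powR_ge0.
have y0 m n : 0 <= y m n by rewrite !mulr_ge0 ?powR_ge0.
have pow3 (t u v l : R) : 0 <= t -> 0 <= u -> 0 <= v ->
    (t * u * v) `^ l = t `^ l * u `^ l * v `^ l.
  by move=> t0 u0 v0; rewrite powRM ?mulr_ge0// powRM.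
have split_scalar (t u v : R) : 0 <= t -> 0 <= u -> 0 <= v ->
    t * u `^ p^-1 * v `^ q^-1 = (t * u) `^ p^-1 * (t * v) `^ q^-1.
  move=> t0 u0 v0; rewrite (powRM _ t0 u0) (powRM _ t0 v0) mulrACA -powRD ?pq ?oner_eq0//.
  by rewrite powRr1// mulrA.
have xp m n : x m n `^ p = a m.+1 `^ p * (r m n `^ q^-1 * w m n).
  rewrite pow3 ?powR_ge0// powRVK ?lt0r_neq0// -powRrM mulrA.
  by congr (_ * _ `^ _ * _); field; rewrite !lt0r_neq0.
have yq m n : y m n `^ q = b n.+1 `^ q * (r n m `^ p^-1 * w n m).
  rewrite pow3 ?powR_ge0// powRVK ?lt0r_neq0// -powRrM mulrA.
  rewrite /w [(n.+1 + _)%N]addnC.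
  by congr (_ * _ `^ _ * _); field; rewrite !lt0r_neq0.
have xy m n : a m.+1 * b n.+1 / (m.+1 + n.+1)%:R = x m n * y m n.
  rewrite /x /y.
  have -> : r n m = (r m n)^-1 by rewrite /r invf_div.
  rewrite -(powR_inv1 (ltW (r0 m n))) -powRrM mulN1r powRN.
  have R0 : r m n `^ (p * q)^-1 != 0 by rewrite gt_eqF// powR_gt0.
  have -> : (m.+1 + n.+1)%:R^-1 = w m n `^ p^-1 * w m n `^ q^-1.
    by rewrite -powRD ?pq ?powRr1// oner_eq0.
  by field.
under eq_bigr do under eq_bigr do rewrite xy.
apply: (le_trans (hoelder_double_sum _ _ x0 y0 p0 q0 pq)).
set A := \sum_(0 <= m < M') a m.+1 `^ p; set B := \sum_(0 <= n < N') b n.+1 `^ q.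
have A0 : 0 <= A by rewrite sumr_ge0// => j _; exact: powR_ge0.
have B0 : 0 <= B by rewrite sumr_ge0// => j _; exact: powR_ge0.
rewrite split_scalar//.
apply: ler_pM; rewrite ?powR_ge0//; apply: powR_le => //.
- by rewrite sumr_ge0// => i _; rewrite sumr_ge0// => j _; exact: powR_ge0.
- rewrite mulr_sumr; apply: ler_sum => m _.
  under eq_bigr do rewrite xp.
  by rewrite -mulr_sumr mulrC ler_wpM2r ?powR_ge0//; exact: weight_q.
- by rewrite sumr_ge0// => i _; rewrite sumr_ge0// => j _; exact: powR_ge0.
- rewrite exchange_big /= mulr_sumr; apply: ler_sum => n _.
  under eq_bigr do rewrite yq.
  by rewrite -mulr_sumr mulrC ler_wpM2r ?powR_ge0//; exact: weight_p.
Qed.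

Lemma pi_div_sin_ge1 (R : realType) (s : R) : 0 < s -> s < 1 ->
  1 <= pi / sin (pi * s).
Proof.
move=> s0 s1; have pi2 := @pi_ge2 R.
have S0 : 0 < sin (pi * s).
  by apply: sin_gt0_pi; rewrite mulr_gt0 ?gtr_pMr//; lra.
by rewrite ler_pdivlMr// mul1r; have := sin_le1 (pi * s); lra.
Qed.

(** The first two pairs are merged into the pair of their norms, and then
    the two-term inequality is used once more. *)
Lemma hoelder3 (R : realType) (x1 x2 x3 y1 y2 y3 p q : R) :
  0 <= x1 -> 0 <= x2 -> 0 <= x3 -> 0 <= y1 -> 0 <= y2 -> 0 <= y3 ->
  0 < p -> 0 < q -> p^-1 + q^-1 = 1 ->
  x1 * y1 + x2 * y2 + x3 * y3 <=
    (x1 `^ p + x2 `^ p + x3 `^ p) `^ p^-1 * (y1 `^ q + y2 `^ q + y3 `^ q) `^ q^-1.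
Proof.
move=> x10 x20 x30 y10 y20 y30 p0 q0 pq.
have X0 : 0 <= x1 `^ p + x2 `^ p by rewrite addr_ge0 ?powR_ge0.
have Y0 : 0 <= y1 `^ q + y2 `^ q by rewrite addr_ge0 ?powR_ge0.
apply: le_trans (lerD (hoelder2 x10 x20 y10 y20 p0 q0 pq) (lexx _)) _.
rewrite -{2}(powRVK X0 (lt0r_neq0 p0)) -{2}(powRVK Y0 (lt0r_neq0 q0)).
by apply: hoelder2; rewrite ?powR_ge0.
Qed.

(** The three products c_0 d_0, |a|_p |b|_q and |c|_p |d|_q, each bounded with
    the same constant, are merged by Hoelder's inequality on three terms. *)
Lemma hilbert_pair_finite (R : realType) (p q : R) (a b c d : nat -> R) (M N : nat) :
  (forall m, 0 <= a m) -> (forall n, 0 <= b n) ->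
  (forall m, 0 <= c m) -> (forall n, 0 <= d n) ->
  0 < p -> 0 < q -> p^-1 + q^-1 = 1 ->
  c 0%N * d 0%N + \sum_(1 <= m < M) \sum_(1 <= n < N)
      (a m * b n / (m + n)%:R + c m * d n / (m + n + 1)%:R) <=
  pi / sin (pi / p) *
    (c 0%N `^ p + \sum_(1 <= m < M) (a m `^ p + c m `^ p)) `^ p^-1 *
    (d 0%N `^ q + \sum_(1 <= n < N) (b n `^ q + d n `^ q)) `^ q^-1.
Proof.
move=> a0 b0 c0 d0 p0 q0 pq.
have pV0 : 0 < p^-1 by rewrite invr_gt0.
have qV0 : 0 < q^-1 by rewrite invr_gt0.
have C1 : 1 <= pi / sin (pi / p) by apply: pi_div_sin_ge1 => //; lra.
have Hab := hilbert_finite M N a0 b0 p0 q0 pq.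
have Hcd := hilbert_finite M N c0 d0 p0 q0 pq.
rewrite 2!(big_split _ _ _ (fun m => _ `^ _)) /=.
move: (pi / _) C1 Hab Hcd => C C1.
have P0 (x : nat -> R) (r : R) L : 0 <= \sum_(1 <= m < L) x m `^ r.
  by rewrite sumr_ge0// => i _; exact: powR_ge0.
have := P0 a p M; have := P0 b q N; have := P0 c p M; have := P0 d q N.
move: (\sum_(1 <= m < M) a m `^ p) (\sum_(1 <= n < N) b n `^ q)
  (\sum_(1 <= m < M) c m `^ p) (\sum_(1 <= n < N) d n `^ q).
move=> A B G D D0 G0 B0 A0 Hab Hcd.
have H3 := hoelder3 (c0 0%N) (powR_ge0 A p^-1) (powR_ge0 G p^-1)
  (d0 0%N) (powR_ge0 B q^-1) (powR_ge0 D q^-1) p0 q0 pq.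
rewrite !powRVK ?lt0r_neq0// in H3.
rewrite !addrA -mulrA; apply: le_trans (ler_wpM2l _ H3); last lra.
rewrite !mulrDr -addrA; apply: lerD.
  by rewrite ler_peMl// mulr_ge0.
apply: (@le_trans _ _ (\sum_(1 <= m < M) \sum_(1 <= n < N) a m * b n / (m + n)%:R +
  \sum_(1 <= m < M) \sum_(1 <= n < N) c m * d n / (m + n)%:R)); last first.
  by apply: lerD; rewrite mulrA.
rewrite -big_split /=; apply: ler_sum_nat => m /andP[m1 _].
rewrite -big_split /=; apply: ler_sum_nat => n /andP[n1 _].
rewrite lerD2l ler_wpM2l ?mulr_ge0// lef_pV2 ?posrE ?ltr0n ?addn1// ?addn_gt0 ?m1//.
by rewrite ler_nat.
Qed.

(** * Passage to infinite sums *)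

Lemma nneseries_le (R : realType) (u : nat -> \bar R) (m : nat) (x : \bar R) :
  (forall n, (0 <= u n)%E) -> (forall n, (\sum_(m <= i < n) u i <= x)%E) ->
  (\sum_(m <= i <oo) u i <= x)%E.
Proof.
move=> u0 ux; apply: lime_le; first by apply: is_cvg_nneseries => n _ _; exact: u0.
exact: nearW.
Qed.

Lemma nneseries_double_le (R : realType) (u : nat -> nat -> R) (m n : nat) (x : R) :
  (forall i j, 0 <= u i j) ->
  (forall M N, \sum_(m <= i < M) \sum_(n <= j < N) u i j <= x) ->
  (\sum_(m <= i <oo) \sum_(n <= j <oo) (u i j)%:E <= x%:E)%E.
Proof.
move=> u0 ux; apply: nneseries_le => [i|M].
  by apply: nneseries_ge0 => j _ _; rewrite lee_fin.
rewrite -nneseries_sum_nat; last by move=> i j; rewrite lee_fin.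
apply: nneseries_le => [j|N]; first by rewrite sume_ge0// => i _; rewrite lee_fin.
under eq_bigr do rewrite sumEFin.
by rewrite sumEFin lee_fin exchange_big_nat.
Qed.

Lemma nneseries_fin (R : realType) (u : nat -> R) (m : nat) :
  (forall i, 0 <= u i) -> (\sum_(m <= i <oo) (u i)%:E < +oo)%E ->
  exists2 x : R, (\sum_(m <= i <oo) (u i)%:E = x%:E)%E &
    forall M, \sum_(m <= i < M) u i <= x.
Proof.
move=> u0 ufin; have v0 i : (0 <= (u i)%:E)%E by rewrite lee_fin.
exists (fine (\sum_(m <= i <oo) (u i)%:E)%E).
  by rewrite fineK// ge0_fin_numE// nneseries_ge0.
move=> M; rewrite -lee_fin fineK ?ge0_fin_numE ?nneseries_ge0//.
rewrite -sumEFin; exact: nneseries_lim_ge.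
Qed.

Unset Implicit Arguments.
Local Open Scope ereal_scope.

(* The infinite sums of nonnegative terms are taken in
   \bar R, so the inequality also asserts that the double sum is finite *)
Theorem theorem2p1 (R : realType) (p q : R) (k : nat) (a b c d : nat -> R)
    (hp : (1 < p)%R) (hq : q = (p / (p - 1))%R) (hk : (1 <= k)%N)
    (ha : forall m : nat, (0 <= a m)%R) (hb : forall m : nat, (0 <= b m)%R)
    (hc : forall m : nat, (0 <= c m)%R) (hd : forall m : nat, (0 <= d m)%R)
    (hap : \sum_(1 <= m <oo) (a m `^ p)%:E < +oo)
    (hbq : \sum_(1 <= m <oo) (b m `^ q)%:E < +oo)
    (hcp : \sum_(0 <= m <oo) (c m `^ p)%:E < +oo)
    (hdq : \sum_(0 <= m <oo) (d m `^ q)%:E < +oo) :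
  (k%:R * c 0%N * d 0%N)%:E
  + \sum_(1 <= m <oo) \sum_(1 <= n <oo)
      (a m * b n / (m + n)%:R + k%:R * c m * d n / (m + n + 1)%:R)%:E
  <= (pi / sin (pi / p))%:E
     * ((k%:R * c 0%N `^ p)%:E
        + \sum_(1 <= m <oo) (a m `^ p + k%:R * c m `^ p)%:E) `^ (1 / p)
     * ((k%:R * d 0%N `^ q)%:E
        + \sum_(1 <= m <oo) (b m `^ q + k%:R * d m `^ q)%:E) `^ (1 / q).
Proof.
have p0 : (0 < p)%R by lra.
have q0 : (0 < q)%R by rewrite hq divr_gt0//; lra.
have pq : (p^-1 + q^-1 = 1)%R by rewrite hq; field; lra.
have pV0 : (0 < p^-1)%R by rewrite invr_gt0.
have qV0 : (0 < q^-1)%R by rewrite invr_gt0.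
have C1 : (1 <= pi / sin (pi / p))%R by apply: pi_div_sin_ge1 => //; lra.
have fin (x y : nat -> R) (r : R) :
    \sum_(1 <= m <oo) (x m `^ r)%:E < +oo ->
    \sum_(0 <= m <oo) (y m `^ r)%:E < +oo ->
    \sum_(1 <= m <oo) (x m `^ r + k%:R * y m `^ r)%:E < +oo.
  move=> hx hy; under eq_eseriesr do rewrite EFinD EFinM.
  rewrite nneseriesD; last 2 first.
  - by move=> i _ _; rewrite lee_fin powR_ge0.
  - by move=> i _ _; rewrite -EFinM lee_fin mulr_ge0 ?powR_ge0.
  rewrite nneseriesZl; last by move=> i _; rewrite lee_fin powR_ge0.
  apply: lte_add_pinfty; first exact: hx.
  apply: lte_mul_pinfty; [by rewrite lee_fin | by [] |].
  apply: le_lt_trans hy; rewrite [leRHS]nneseries_recl//; last first.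
    by move=> i _; rewrite lee_fin powR_ge0.
  by rewrite leeDr// lee_fin powR_ge0.
have [|X -> HX] := nneseries_fin _ (fin _ _ _ hap hcp).
  by move=> i; rewrite addr_ge0 ?mulr_ge0 ?powR_ge0.
have [|Y -> HY] := nneseries_fin _ (fin _ _ _ hbq hdq).
  by move=> i; rewrite addr_ge0 ?mulr_ge0 ?powR_ge0.
rewrite -!EFinD !poweR_EFin -!EFinM !div1r -leeBrDl// -EFinB.
apply: nneseries_double_le => [m n|M N].
  by rewrite addr_ge0 ?divr_ge0 ?mulr_ge0.
rewrite lerBrDl.
(* The factor k is split between c and d, since 1/p + 1/q = 1. *)
pose c' m := (k%:R `^ p^-1 * c m)%R; pose d' n := (k%:R `^ q^-1 * d n)%R.
have c'0 m : (0 <= c' m)%R by rewrite mulr_ge0 ?powR_ge0.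
have d'0 n : (0 <= d' n)%R by rewrite mulr_ge0 ?powR_ge0.
have c'p m : (c' m `^ p = k%:R * c m `^ p)%R.
  by rewrite powRM ?powR_ge0// powRVK ?lt0r_neq0.
have d'q n : (d' n `^ q = k%:R * d n `^ q)%R.
  by rewrite powRM ?powR_ge0// powRVK ?lt0r_neq0.
have c'd' m n : (k%:R * c m * d n = c' m * d' n)%R.
  have -> : (k%:R = k%:R `^ p^-1 * k%:R `^ q^-1 :> R)%R.
    by rewrite -powRD ?pq ?oner_eq0// powRr1.
  by rewrite /c' /d'; ring.
rewrite c'd'; under eq_bigr do under eq_bigr do rewrite c'd'.
apply: (le_trans (hilbert_pair_finite M N ha hb c'0 d'0 p0 q0 pq)).
have S0 (x y : nat -> R) (r : R) L :
    (0 <= y 0%N `^ r + \sum_(1 <= m < L) (x m `^ r + y m `^ r))%R.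
  by rewrite addr_ge0 ?powR_ge0// sumr_ge0// => i _; rewrite addr_ge0 ?powR_ge0.
have C0 := le_trans ler01 C1.
apply: ler_pM; rewrite ?powR_ge0//.
- by rewrite mulr_ge0 ?powR_ge0.
- rewrite ler_wpM2l//.
  apply: powR_le => //; rewrite c'p lerD2l.
  by under eq_bigr do rewrite c'p.
- apply: powR_le => //; rewrite d'q lerD2l.
  by under eq_bigr do rewrite d'q.
Qed.
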